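(* Let $r\ge 1$ be an integer, let $\mathcal{B}$ be any board, and let $\mathbb{P}$ be a rider with $r$ basic moves, with move set $\mathbf{M}=\{m_1,\dots,m_r\}$. The number of unlabelled combinatorial types of nonattacking configurations of $3$ copies of $\mathbb{P}$ on dilations of $\mathcal{B}$ equals $$\tfrac13\, r\,(r^2+3r-1).$$ Moreover, the set of combinatorial types of nonattacking configurations of $3$ copies depends only on $r$ and, up to reorientation, is independent of the move set: if $\mathbf{M}$ and $\mathbf{M}'$ are any two move sets with $r$ basic moves, each indexed in increasing order of slope, and $\mathcal{B},\mathcal{B}'$ are any two boards, then the set of combinatorial types of three copies of the rider with move set $\mathbf{M}$ on dilations of $\mathcal{B}$ and the set of combinatorial types of three copies of the rider with move set $\mathbf{M}'$ on dilations of $\mathcal{B}'$ are equal up to reorientation.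
   Context: **Board.** A board $\mathcal{B}$ is a closed, bounded, convex polygonal region in $\mathbb{R}^2$ with nonempty interior $\mathcal{B}^\circ$. (Its vertices need not be rational.) The working board of order $n$ (for an integer $n\ge 1$) is $(n+1)\mathcal{B}^\circ\cap\mathbb{Z}^2$. ''On dilations of the board'' means that all orders $n$ are allowed. **Rider.** A rider $\mathbb{P}$ with $r$ basic moves is given by its move set $\mathbf{M}=\{m_1,\dots,m_r\}$ of nonzero vectors $m_j=(c_j,d_j)\in\mathbb{R}^2$, no two of which are parallel; equivalently, the slopes $\mu_j=d_j/c_j\in\mathbb{R}\cup\{\infty\}$ are distinct. (For actual chess pieces the $m_j$ are integer vectors, but rationality of the slopes is not needed for combinatorial types.) The moves are indexed so that $\mu_1<\mu_2<\cdots<\mu_r$, with $\infty$ regarded as larger than every real number. A piece at $z_0$ attacks every point $z$ with $z-z_0=\lambda m_j$ for some $j$ and some $\lambda\in\mathbb{R}$; the line through $z_0$ in direction $m_j$ is its $j$-th move line. **Nonattacking configuration.** A nonattacking configuration of $q$ labelled copies $\mathbb{P}_1,\dots,\mathbb{P}_q$ of $\mathbb{P}$ on the board of order $n$ is a $q$-tuple $(z_1,\dots,z_q)$ of points of $(n+1)\mathcal{B}^\circ\cap\mathbb{Z}^2$ such that $z_k$ does not lie on any move line through $z_i$ whenever $i\ne k$. **Combinatorial type.** Orient each move line by the direction of its basic move, so that it has a left side and a right side. The labelled combinatorial type of a nonattacking configuration is the function that assigns to each triple $(i,j,k)$ with $i,k\in\{1,\dots,q\}$, $i\neq k$, $j\in\{1,\dots,r\}$,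 the side (left or right) of the $j$-th move line of $\mathbb{P}_i$ on which $\mathbb{P}_k$ lies, i.e. the sign of $\det(m_j, z_k-z_i)$. An unlabelled combinatorial type is an equivalence class of labelled combinatorial types under permutation of the labels $1,\dots,q$ of the pieces. The set of combinatorial types (labelled or unlabelled) of $q$ copies of $\mathbb{P}$ on dilations of $\mathcal{B}$ is the set of all types that occur for nonattacking configurations on the working board of some order $n\ge1$. **Reorientation.** Reversing a set of basic moves (replacing $m_j$ by $-m_j$ for all $j$ in some $S\subseteq\{1,\dots,r\}$) interchanges left and right in the values at all triples $(i,j,k)$ with $j\in S$. Two sets of combinatorial types are equal up to reorientation if for some $S\subseteq\{1,\dots,r\}$ one is obtained from the other by interchanging left and right in all values at triples $(i,j,k)$ with $j\in S$, for every type in the set. *)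

(* Defs.v *)
From HB Require Import structures.
From mathcomp Require Import all_boot all_order all_algebra perm.
From mathcomp Require Import all_classical all_reals all_analysis.

Set Implicit Arguments.
Unset Strict Implicit.
Unset Printing Implicit Defensive.

Import Order.TTheory GRing.Theory Num.Theory.
Import numFieldNormedType.Exports.

Local Open Scope classical_set_scope.
Local Open Scope ring_scope.

Section Plane.
Variable R : realType.
Implicit Types (B : set (R * R)) (u v z : R * R).

Definition det2 u v : R := u.1 * v.2 - u.2 * v.1.

Definition point_of_int (z : int * int) : R * R := (z.1%:~R, z.2%:~R).

Definition convex_hull (k : nat) (v : 'I_k -> R * R) : set (R * R) :=
  [set p | exists w : 'I_k -> R,
     [/\ forall i, 0 <= w i, \sum_i w i = 1 & p = \sum_i w i *: v i]].

(* A closed bounded convex polygonal region is the convex hull of finitely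
   many points; closedness and boundedness are automatic.  The interior is
   taken in the product topology of R * R. *)
Definition is_board B :=
  (exists (k : nat) (v : 'I_k -> R * R), B = convex_hull v) /\ B° !=set0.

Definition working_board B (n : nat) : set (int * int) :=
  [set z | exists2 p, B° p & point_of_int z = n.+1%:R *: p].

Definition slope v : \bar R := if v.1 == 0 then +oo%E else (v.2 / v.1)%:E.

Definition is_rider (r : nat) (m : 'I_r -> R * R) :=
  (forall j, m j != 0) /\
  (forall j l : 'I_r, (j < l)%N -> (slope (m j) < slope (m l))%E).

Section Configurations.
Variables (r q : nat) (m : 'I_r -> R * R).

Definition move_line (j : 'I_r) z0 : set (R * R) :=
  [set z | exists lambda : R, z - z0 = lambda *: m j].

Definition nonattacking (z : 'I_q -> int * int) :=
  forall i k : 'I_q, i != k -> forall j : 'I_r,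
    ~ move_line j (point_of_int (z i)) (point_of_int (z k)).

End Configurations.
End Plane.

Definition triple (q r : nat) :=
  {t : 'I_q * 'I_r * 'I_q | t.1.1 != t.2}.

Definition piece1 q r (t : triple q r) : 'I_q := (val t).1.1.
Definition move q r (t : triple q r) : 'I_r := (val t).1.2.
Definition piece2 q r (t : triple q r) : 'I_q := (val t).2.

(* [true] stands for the left side of the oriented move line, [false] for the
   right side. *)
Definition labelled_type (q r : nat) := {ffun triple q r -> bool}.

Section Types.
Variables (q r : nat).

Lemma relabel_triple_subproof (s : 'S_q) (t : triple q r) :
  (s (piece1 t), move t, s (piece2 t)).1.1
    != (s (piece1 t), move t, s (piece2 t)).2.
Proof. by rewrite (inj_eq perm_inj) (valP t). Qed.

Definition relabel_triple (s : 'S_q) (t : triple q r) : triple q r :=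
  exist _ (s (piece1 t), move t, s (piece2 t)) (relabel_triple_subproof s t).

Definition relabel (s : 'S_q) (T : labelled_type q r) : labelled_type q r :=
  [ffun t => T (relabel_triple s t)].

(* An unlabelled type is represented by the set of labelled types in it. *)
Definition unlabelled_type := {set labelled_type q r}.

Definition unlabel (T : labelled_type q r) : unlabelled_type :=
  [set relabel s T | s : 'S_q]%SET.

Definition reorient (S : {set 'I_r}) (T : labelled_type q r) :
    labelled_type q r :=
  [ffun t => (move t \in S) (+) T t].

Definition labelled_eq_up_to_reorientation
    (A A' : {set labelled_type q r}) :=
  exists S : {set 'I_r}, A' = [set reorient S T | T in A]%SET.

Definition unlabelled_eq_up_to_reorientation
    (A A' : {set unlabelled_type}) :=
  exists S : {set 'I_r},
    A' = [set [set reorient S T | T in C] | C : unlabelled_type in A]%SET.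

Variable R : realType.

Definition type_of (m : 'I_r -> R * R) (z : 'I_q -> int * int) :
    labelled_type q r :=
  [ffun t => 0 < det2 (m (move t))
                      (point_of_int R (z (piece2 t)) -
                       point_of_int R (z (piece1 t)))].

Definition occurs (B : set (R * R)) (m : 'I_r -> R * R)
    (T : labelled_type q r) : Prop :=
  exists n : nat, (1 <= n)%N /\
  exists z : 'I_q -> int * int,
    [/\ forall i, working_board B n (z i), nonattacking m z
      & T = type_of m z].

Definition labelled_types (B : set (R * R)) (m : 'I_r -> R * R) :
    {set labelled_type q r} :=
  [set T | `[< occurs B m T >]]%SET.

Definition unlabelled_types (B : set (R * R)) (m : 'I_r -> R * R) :
    {set unlabelled_type} :=
  [set unlabel T | T in labelled_types B m]%SET.

End Types.

Arguments labelled_types q {r R} B m.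
Arguments unlabelled_types q {r R} B m.

(* Main.v *)
Require Import Defs.
From HB Require Import structures.
From mathcomp Require Import all_boot all_order all_algebra perm.
From mathcomp Require Import all_classical all_reals all_analysis.
From mathcomp Require Import ring lra zify.

Import Order.TTheory GRing.Theory Num.Theory.
Import numFieldNormedType.Exports.

Local Open Scope classical_set_scope.
Local Open Scope ring_scope.

Set Implicit Arguments.
Unset Strict Implicit.
Unset Printing Implicit Defensive.

(* Reversing the moves that point downwards, we may assume [0 < det2 (m j) (m l)]
   for [j < l].  Then a type is realizable if and only if it is antisymmetric
   and transitive along each move and each of its rows
   [j |-> side of z_k - z_i] changes sign at most once.  For sufficiency with
   three pieces, let [a], [b], [c] be the rows of [z_2 - z_1], [z_3 - z_2],
   [z_3 - z_1], and choose vectors [x], [y], [z] realizing them separately.  If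
   [c] differs from both [a] and [b], and [b] is not opposite to [a], then [z]
   lies in the cone spanned by [x] and [y]; in the other cases one adds a
   multiple of a dominating vector.  The resulting real configuration is
   shrunk into the board and approximated by lattice points.
   An unlabelled type has a unique representative in which the pieces are
   sorted along the first move; its rows are then given by three levels with
   the third one between the other two, and such triples of levels are
   counted by induction on [r]. *)

(** * Labelled types as functions of pieces and moves; relabelling and reorientation *)

Section Sides.
Variables q r : nat.
Implicit Types (T : labelled_type q r) (i k l : 'I_q) (j : 'I_r).

(** The default value [false] at [i = k] makes the function total and spares later arguments the
    subtype [triple]. *)
Definition side T i j k : bool :=
  if insub (i, j, k) is Some t then T t else false.

Lemma side_triple T (t : triple q r) :
  side T (piece1 t) (move t) (piece2 t) = T t.
Proof.
by rewrite /side /piece1 /move /piece2 -!surjective_pairing valK.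
Qed.

Lemma side_inj T T' :
  (forall i j k, i != k -> side T i j k = side T' i j k) -> T = T'.
Proof.
by move=> TT'; apply/ffunP => t; rewrite -!side_triple TT' ?(valP t).
Qed.

Lemma side_finfun (F : 'I_q -> 'I_r -> 'I_q -> bool) i j k :
  side [ffun t => F (piece1 t) (move t) (piece2 t)] i j k
    = (i != k) && F i j k.
Proof.
rewrite /side; case: insubP => [t /= -> tE|/= /negbTE-> //].
rewrite ffunE /piece1 /move /piece2.
by case: t tE => -[[a b] c] h /= [-> -> ->].
Qed.

Lemma sideii T i j : side T i j i = false.
Proof. by rewrite /side insubN //= eqxx. Qed.

Lemma side_relabel s T i j k :
  side (relabel s T) i j k = side T (s i) j (s k).
Proof.
have [<-|ik] := eqVneq i k; first by rewrite !sideii.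
have -> : relabel s T = [ffun t => side T (s (piece1 t)) (move t) (s (piece2 t))].
  by apply/ffunP => t; rewrite !ffunE -side_triple.
by rewrite (side_finfun (fun i j k => side T (s i) j (s k))) ik.
Qed.

Lemma side_reorient S T i j k :
  i != k -> side (reorient S T) i j k = (j \in S) (+) side T i j k.
Proof.
move=> ik.
have -> : reorient S T = [ffun t => (move t \in S) (+)
    side T (piece1 t) (move t) (piece2 t)].
  by apply/ffunP => t; rewrite !ffunE side_triple.
by rewrite (side_finfun (fun i j k => (j \in S) (+) side T i j k)) ik.
Qed.

(** In [side_trans] the pieces need not be distinct: for [i = l] the conclusion is the default
    [false], which agrees with [side_flip]. *)
Record admissible T : Prop := Admissible {
  side_flip : forall i j k, i != k -> side T k j i = ~~ side T i j k;
  side_trans : forall i j k l, side T i j k -> side T k j l -> side T i j l;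
  side_convex : forall i k j1 j2 j3, (j1 <= j2 <= j3)%N ->
    side T i j1 k = side T i j3 k -> side T i j2 k = side T i j1 k }.

Lemma admissible_relabel s T : admissible T -> admissible (relabel s T).
Proof.
case=> flip trans cvx; split=> [i j k|i j k l|i k j1 j2 j3]; rewrite !side_relabel.
- by move=> ik; apply: flip; rewrite (inj_eq perm_inj).
- exact: trans.
- exact: cvx.
Qed.

Lemma reorientK S : involutive (reorient S : labelled_type q r -> _).
Proof.
by move=> T; apply/ffunP => t; rewrite !ffunE addbA addbb.
Qed.

Lemma reorient_comp (S S' S'' : {set 'I_r}) T :
  (forall j, (j \in S'') = (j \in S) (+) (j \in S')) ->
  reorient S (reorient S' T) = reorient S'' T.
Proof. by move=> SE; apply/ffunP => t; rewrite !ffunE SE addbA. Qed.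

Lemma unlabel_reorient S T :
  unlabel (reorient S T) = (reorient S @: unlabel T)%SET.
Proof.
rewrite /unlabel -imset_comp; apply: eq_imset => s /=.
by apply/ffunP => t; rewrite !ffunE.
Qed.

Lemma relabel_comp s s' T : relabel s (relabel s' T) = relabel (s * s')%g T.
Proof. by apply: side_inj => i j k _; rewrite !side_relabel !permM. Qed.

Lemma relabel1 T : relabel 1 T = T.
Proof. by apply: side_inj => i j k _; rewrite side_relabel !perm1. Qed.

Lemma mem_unlabel T : T \in unlabel T.
Proof. by apply/imsetP; exists 1%g; rewrite ?relabel1. Qed.

Lemma unlabel_relabel s T : unlabel (relabel s T) = unlabel T.
Proof.
apply/setP => T'; apply/imsetP/imsetP => -[s' _ ->].
  by exists (s' * s)%g; rewrite ?relabel_comp.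
by exists (s' * s^-1)%g; rewrite // relabel_comp -mulgA mulVg mulg1.
Qed.

Lemma unlabelP T T' : reflect (exists s, T' = relabel s T) (unlabel T == unlabel T').
Proof.
apply: (iffP eqP) => [TT'|[s ->]]; last by rewrite unlabel_relabel.
have := mem_unlabel T'; rewrite -TT' => /imsetP[s _ ->]; by exists s.
Qed.

End Sides.

Definition admissible_types q r : {set labelled_type q r} :=
  [set T | `[< admissible T >]]%SET.

(** * Sorting the pieces along one move *)

Section Sorting.
Variables q r : nat.
Implicit Types (T : labelled_type q r) (j : 'I_r).

Definition sorted_at j T := forall i k, side T i j k = (i < k)%N.

Lemma card_ord_lt n (k : 'I_n) : #|[set i : 'I_n | (i < k)%N]%SET| = k.
Proof.
rewrite -sum1_card; under eq_bigl do rewrite inE.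
by rewrite -(big_ord_widen n (fun=> 1%N) (ltnW (ltn_ord k))) sum1_card card_ord.
Qed.

(* Along the j-th move the pieces are totally ordered; the label of a piece in
   the sorted relabelling is the number of pieces before it. *)
Lemma exists_sorted_relabel j T : admissible T -> exists s, sorted_at j (relabel s T).
Proof.
move=> [flip trans _].
pose before k := [set i | side T i j k]%SET.
(* No piece comes before itself, so fewer than [q] pieces come before [k]. *)
have before_lt k : (#|before k| < q)%N.
  rewrite -[ltnRHS]card_ord; apply: proper_card; apply/properP; split.
    exact/subset_predT.
  by exists k; rewrite ?inE ?sideii.
pose rank k := Ordinal (before_lt k).
have side_rank i k : side T i j k -> (rank i < rank k)%N.
  move=> ik; apply: proper_card; apply/properP; split.
    by apply/fintype.subsetP => l; rewrite !inE => /trans; apply.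
  by exists i; rewrite !inE ?sideii.
have rankE i k : side T i j k = (rank i < rank k)%N.
  apply/idP/idP; first exact: side_rank.
  have [->|ik] := eqVneq i k; first by rewrite ltnn.
  apply: contraTT; rewrite -flip // => /side_rank.
  by rewrite -leqNgt => /ltnW.
have rank_inj : injective rank.
  move=> i k eq_ik; apply: contraTeq isT => ik.
  by have := flip i j k ik; rewrite !rankE eq_ik ltnn.
exists (perm rank_inj)^-1%g => i k.
by rewrite side_relabel rankE -![rank _](permE rank_inj) !permKV.
Qed.

(** An element of ['I_q] equals the number of elements below it, and an increasing [s] maps the
    elements below [i] onto those below [s i]. *)
Lemma increasing_perm1 (s : 'S_q) :
  (forall i k, (s i < s k)%N = (i < k)%N) -> s = 1%g.
Proof.
move=> s_incr; apply/permP => i; rewrite perm1; apply: val_inj => /=.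
rewrite -[LHS]card_ord_lt -[RHS]card_ord_lt -[RHS](card_imset _ (@perm_inj _ s)).
congr #|pred_of_set _|; apply/setP => k; rewrite inE -[k](permKV s).
by rewrite mem_imset ?inE ?s_incr //; exact: perm_inj.
Qed.

(** Two sorted relabellings differ by an increasing permutation, so the sorted representative of an
    unlabelled type is unique. *)
Lemma sorted_relabel1 j T s :
  sorted_at j T -> sorted_at j (relabel s T) -> relabel s T = T.
Proof.
move=> sT sT'; rewrite (increasing_perm1 (s := s)) ?relabel1 // => i k.
by rewrite -sT -side_relabel sT'.
Qed.

End Sorting.

(** * Encoding sorted types of three pieces by levels, and counting them *)

Section Counting.
Variable r : nat.
Notation levels := ('I_r.+1 * 'I_r.+1 * 'I_r.+1)%type.
Implicit Types (t : levels).

(* [level t i k], for [i < k], is the last move along which piece [i] comes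
   before piece [k]. *)
Definition level t (i k : 'I_3) : 'I_r.+1 :=
  if i == 0 :> nat then (if k == 1 :> nat then t.1.1 else t.2) else t.1.2.

(** Every level is at least [0], so along the first move the pieces are sorted by label. The values
    with [k < i] are forced by antisymmetry. *)
Definition type_of_levels t : labelled_type 3 r.+1 :=
  [ffun x => let: (i, j, k) := (piece1 x, move x, piece2 x) in
     if (i < k)%N then (j <= level t i k)%N else ~~ (j <= level t k i)%N].

(** Transitivity of coming before bounds the level of pieces 0 and 2 below by the minimum of the
    other two levels; transitivity of coming after bounds it above by their maximum. *)
Definition between_levels : {set levels} :=
  [set t : levels | minn t.1.1 t.1.2 <= t.2 <= maxn t.1.1 t.1.2]%N%SET.

Lemma side_type_of_levels t i j k : side (type_of_levels t) i j k =
  (i != k) && if (i < k)%N then (j <= level t i k)%N else ~~ (j <= level t k i)%N.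
Proof.
exact: (side_finfun (fun i (j : 'I_r.+1) k =>
  if (i < k)%N then (j <= level t i k)%N else ~~ (j <= level t k i)%N)).
Qed.

Lemma sorted_type_of_levels t : sorted_at ord0 (type_of_levels t).
Proof.
move=> i k; rewrite side_type_of_levels /= -(inj_eq val_inj) /=.
by case: ltngtP.
Qed.

Definition o0 : 'I_3 := @Ordinal 3 0 isT.
Definition o1 : 'I_3 := @Ordinal 3 1 isT.
Definition o2 : 'I_3 := @Ordinal 3 2 isT.

Lemma ord3P (i : 'I_3) : [\/ i = o0, i = o1 | i = o2].
Proof.
by case: i => [[|[|[|//]]] ?]; [constructor 1|constructor 2|constructor 3];
  apply: val_inj.
Qed.

Lemma type_of_levels_inj : injective type_of_levels.
Proof.
move=> t t' eq_tt'.
have lev (i k : 'I_3) : (i < k)%N -> level t i k = level t' i k.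
  move=> ik; have ik' : (i != k) by rewrite -(inj_eq val_inj) neq_ltn /= ik.
  have le (j : 'I_r.+1) : (j <= level t i k)%N = (j <= level t' i k)%N.
    have := congr1 (fun T => side T i j k) eq_tt'.
    by rewrite !side_type_of_levels ik ik'.
  by apply/val_inj/eqP; rewrite eqn_leq -le leqnn /= le leqnn.
have := lev o0 o1 isT; have := lev o1 o2 isT; have := lev o0 o2 isT.
by case: t t' {eq_tt' lev} => [[a b] c] [[a' b'] c']; rewrite /level /= => -> -> ->.
Qed.

Lemma type_of_levels_admissible t :
  t \in between_levels -> admissible (type_of_levels t).
Proof.
rewrite inE => bt; split.
- move=> i j k ik; rewrite !side_type_of_levels [k == i]eq_sym ik /=.
  move: ik; rewrite -(inj_eq val_inj) /=; case: ltngtP => //= _ _.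
  by rewrite negbK.
- move=> i j k l; rewrite !side_type_of_levels -!(inj_eq val_inj).
  case: t bt => [[a b] c] /=.
  by case: (ord3P i) => ->; case: (ord3P k) => ->; case: (ord3P l) => ->;
    rewrite /level //=; lia.
- move=> i k j1 j2 j3; rewrite !side_type_of_levels.
  by case: (i != k) => //=; case: ifP => _ /=; lia.
Qed.

Lemma sorted_type_levels T : admissible T -> sorted_at ord0 T ->
  exists2 t, t \in between_levels & T = type_of_levels t.
Proof.
move=> [flip trans cvx] sT.
have last_before (i k : 'I_3) : (i < k)%N ->
    exists l : 'I_r.+1, forall j, side T i j k = (j <= l)%N.
  move=> ik; have Tik0 : side T i ord0 k by rewrite sT.
  (* A row that starts with [true] and changes at most once is an initial segment, and its end is
     the level. The move [ord0] is a valid candidate because [T] is sorted along it. *)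
  exists [arg max_(l > ord0 | side T i l k) l]; case: arg_maxnP => //= l il max_l j.
  apply/idP/idP => [|jl]; first exact: max_l.
  by rewrite (cvx _ _ ord0 j l) ?Tik0 ?il.
have [a Ta] := last_before o0 o1 isT.
have [b Tb] := last_before o1 o2 isT.
have [c Tc] := last_before o0 o2 isT.
exists (a, b, c).
  rewrite inE /=.
  have ge_c (j : 'I_r.+1) : (j <= a -> j <= b -> j <= c)%N.
    by rewrite -Ta -Tb -Tc; exact: trans.
  have := ge_c a; have := ge_c b.
  (* Along move [c] piece 0 precedes piece 2; if piece 1 precedes piece 0 there, it also precedes
     piece 2. *)
  have : (c <= a \/ c <= b)%N.
    rewrite -Ta -Tb; case: (boolP (side T o0 c o1)) => [|Tc01]; first by left.
    by right; apply: (trans o1 c o0 o2); rewrite ?Tc // flip.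
  by rewrite !leqnn; lia.
apply: side_inj => i j k ik; rewrite side_type_of_levels ik /=.
have le (i' k' : 'I_3) : (i' < k')%N -> side T i' j k' = (j <= level (a, b, c) i' k')%N.
  by case: (ord3P i') => ->; case: (ord3P k') => ->; rewrite /level /= ?Ta ?Tb ?Tc.
case: ltngtP (ik) => [ik' _|ki _|/val_inj->]; rewrite ?eqxx //; first exact: le.
by rewrite flip 1?eq_sym // le.
Qed.

(** The summand is the number of third levels between [a] and [b], both included. *)
Definition sum_levels n := (\sum_(a < n) \sum_(b < n) (maxn a b - minn a b).+1)%N.

(** Sorting brings each class to a type given by levels, and uniqueness of the sorted representative
    separates the classes of distinct levels. *)
Lemma card_unlabel_admissible :
  #|(@unlabel 3 r.+1 @: admissible_types 3 r.+1)%SET| = #|between_levels|.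
Proof.
have -> : (@unlabel 3 r.+1 @: admissible_types 3 r.+1
    = [set unlabel (type_of_levels t) | t in between_levels])%SET.
  apply/setP => C; apply/imsetP/imsetP => -[].
    move=> T; rewrite inE => /asboolP admT ->.
    have [s sT] := exists_sorted_relabel ord0 admT.
    have [t tb tE] := sorted_type_levels (admissible_relabel s admT) sT.
    by exists t; rewrite // -tE unlabel_relabel.
  move=> t tb ->; exists (type_of_levels t) => //.
  by rewrite inE; apply/asboolP/type_of_levels_admissible.
rewrite card_in_imset // => t t' _ _ /eqP/unlabelP[s sE].
apply: type_of_levels_inj; rewrite sE.
have sorted_t := sorted_type_of_levels t.
rewrite (sorted_relabel1 sorted_t) // -sE; exact: sorted_type_of_levels.
Qed.

Lemma card_between_levels : #|between_levels| = sum_levels r.+1.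
Proof.
have itv (a b : 'I_r.+1) : (maxn a b - minn a b).+1 =
    (\sum_(c < r.+1 | (c < (maxn a b).+1) && (minn a b <= c)) 1)%N.
  have ltM : (maxn a b < r.+1)%N by rewrite gtn_max !ltn_ord.
  transitivity (\sum_(minn a b <= c < (maxn a b).+1) 1)%N.
    by rewrite sum_nat_const_nat muln1 subSn // geq_min leq_max leqnn.
  by rewrite (big_nat_widen _ _ r.+1) // (big_nat_widenl _ 0) // big_mkord.
rewrite /sum_levels -sum1_card.
under [RHS]eq_bigr do under eq_bigr do rewrite itv.
rewrite pair_bigA /= pair_big_dep /=.
by apply: eq_bigl => t; rewrite inE ltnS andbC.
Qed.

(** The closed form n(n^2 + 3n - 1)/3, free of division and subtraction. Passing from [n] to [n.+1]
    adds a row and a column with equal sums, and a corner term [1]. *)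
Lemma sum_levelsE n : (3 * sum_levels n + n = n ^ 3 + 3 * n ^ 2)%N.
Proof.
elim: n => [|n IHn]; first by rewrite /sum_levels big_ord0.
(* The limit [k] is separated from [n] so that the summand stays fixed in the induction. *)
have row k : (k <= n -> 2 * (\sum_(b < k) (n - b).+1) = k * (2 * n + 3 - k))%N.
  elim: k => [|k IHk] kn; first by rewrite big_ord0.
  by rewrite big_ord_recr /= mulnDr IHk; nia.
have gap (b : 'I_n) : (maxn n b - minn n b = n - b)%N.
  by have := ltn_ord b; lia.
have sumS : sum_levels n.+1 = (sum_levels n + (2 * \sum_(b < n) (n - b).+1).+1)%N.
  rewrite /sum_levels big_ord_recr /=.
  under eq_bigr do rewrite big_ord_recr /= maxnC minnC gap.
  rewrite big_split big_ord_recr /=.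
  under [X in (_ + (X + _))%N]eq_bigr do rewrite gap.
  by rewrite maxnn minnn subnn; lia.
by rewrite sumS row //; nia.
Qed.

End Counting.

(** * Determinants, and vectors with one prescribed row of sides *)

Section Plane.
Variable R : realType.
Implicit Types (u v w : R * R).

Lemma det2Dr u v w : det2 u (v + w) = det2 u v + det2 u w.
Proof. by rewrite /det2 /=; ring. Qed.

Lemma det2Nl u v : det2 (- u) v = - det2 u v.
Proof. by rewrite /det2 /=; ring. Qed.

Lemma det2Nr u v : det2 u (- v) = - det2 u v.
Proof. by rewrite /det2 /=; ring. Qed.

Lemma det2Zr a u v : det2 u (a *: v) = a * det2 u v.
Proof. by rewrite /det2 /= /GRing.scale /=; ring. Qed.

Lemma det2C u v : det2 u v = - det2 v u.
Proof. by rewrite /det2; ring. Qed.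

Lemma det2uu u : det2 u u = 0.
Proof. by rewrite /det2; ring. Qed.

(** The three-term Plücker relation, which ties together signs along different directions. *)
Lemma det2_plucker u v w x :
  det2 u w * det2 v x - det2 v w * det2 u x = det2 u v * det2 w x.
Proof. by rewrite /det2; ring. Qed.

Lemma det2_eq0P u v : u != 0 -> reflect (exists a, v = a *: u) (det2 u v == 0).
Proof.
move=> u0; apply: (iffP eqP) => [|[a ->]]; last by rewrite det2Zr det2uu mulr0.
case: u v u0 => [u1 u2] [v1 v2]; rewrite xpair_eqE negb_and /det2 /= => u0 uv.
have pairZ (a x y : R) : a *: (x, y) = (a * x, a * y) by [].
case/orP: u0 => u0; [exists (v1 / u1)|exists (v2 / u2)];
  rewrite pairZ divfK //; congr (_, _); apply: (mulIf u0);
  rewrite mulrAC divfK //; lra.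
Qed.

Lemma move_lineP r (m : 'I_r -> R * R) j u v : m j != 0 ->
  reflect (move_line m j u v) (det2 (m j) (v - u) == 0).
Proof. by move=> mj0; apply: (iffP (det2_eq0P _ mj0)). Qed.

Section Rider.
Variables (r : nat) (m : 'I_r -> R * R).

Definition pos_ordered :=
  forall j l : 'I_r, (j < l)%N -> 0 < det2 (m j) (m l).

Hypothesis m_pos : pos_ordered.

Lemma pos_ordered_le (j l : 'I_r) : (j <= l)%N -> 0 <= det2 (m j) (m l).
Proof.
by rewrite leq_eqVlt => /orP[/eqP/val_inj->|/m_pos/ltW//]; rewrite det2uu.
Qed.

(* The sign of [det2 (m j) u] changes at most once as [j] increases, since
   [m j2] is a positive combination of [m j1] and [m j3]. *)
Lemma pos_ordered_convex (j1 j2 j3 : 'I_r) u : (forall j, det2 (m j) u != 0) ->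
  (j1 <= j2 <= j3)%N -> (0 < det2 (m j1) u) = (0 < det2 (m j3) u) ->
  (0 < det2 (m j2) u) = (0 < det2 (m j1) u).
Proof.
rewrite [(j1 <= j2)%N]leq_eqVlt [(j2 <= j3)%N]leq_eqVlt => u0.
move=> /andP[/orP[/eqP/val_inj->//|j12] /orP[/eqP/val_inj->//|j23]].
have d13 := m_pos (ltn_trans j12 j23).
have d12 := m_pos j12; have d23 := m_pos j23.
have /eqP := det2_plucker (m j1) (m j2) (m j3) u; rewrite subr_eq => /eqP E.
move=> eq13; rewrite -[LHS](pmulr_rgt0 _ d13) E; move: eq13; have := u0 j1; have := u0 j3.
case: (ltgtP 0 (det2 (m j1) u)) => // u1; case: (ltgtP 0 (det2 (m j3) u)) => // u3 _ _ _.
  by rewrite addr_gt0 ?mulr_gt0.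
apply/negbTE; rewrite -leNgt -oppr_ge0 opprD -!mulrN.
by rewrite addr_ge0 ?mulr_ge0 ?oppr_ge0 // ltW.
Qed.

End Rider.

Definition row_convex r (a : 'I_r -> bool) := forall j1 j2 j3 : 'I_r,
  (j1 <= j2 <= j3)%N -> a j1 = a j3 -> a j2 = a j1.

(** The factor is [1] where [a j] holds and [-1] elsewhere, so one strict inequality covers both
    sides and excludes the move line itself. *)
Definition has_sides r (m : 'I_r -> R * R) (a : 'I_r -> bool) u :=
  forall j, 0 < (-1) ^+ (~~ a j) * det2 (m j) u.

Lemma has_sidesN r (m : 'I_r -> R * R) a u :
  has_sides m a u -> has_sides m (fun j => ~~ a j) (- u).
Proof.
move=> h j; have := h j; rewrite det2Nr; case: (a j) => /=; rewrite ?expr0 ?expr1; lra.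
Qed.

(** Finitely many strict inequalities linear in [u] are involved, so a large multiple of [u]
    outweighs [v]. *)
Lemma has_sides_dominated r (m : 'I_r -> R * R) a u v :
  has_sides m a u -> exists K, 0 < K /\ has_sides m a (K *: u + v).
Proof.
move=> hu; pose p j := (-1) ^+ (~~ a j) * det2 (m j) u.
pose c j := (-1) ^+ (~~ a j) * det2 (m j) v.
have c_ge0 j : 0 <= `|c j| / p j by rewrite divr_ge0 // ltW // hu.
(* This constant times [p j] is at least [p j + |c j|], the other terms being nonnegative. *)
exists (1 + \sum_j `|c j| / p j); split=> [|j]; first by rewrite ltr_wpDr ?sumr_ge0.
rewrite det2Dr det2Zr mulrDr mulrCA -/(p j) -/(c j) (bigD1 j) //=.
have pj : 0 < p j := hu j.
rewrite !mulrDl divfK ?gt_eqF //.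
have : 0 <= (\sum_(i | i != j) `|c i| / p i) * p j.
  by rewrite mulr_ge0 ?sumr_ge0 // ltW.
have := ler_norm (- c j); rewrite normrN; lra.
Qed.

(* Up to a sign, [a] holds exactly up to some move [l]; then [m l + m l.+1] is a
   witness, or [m l - m 0] if [l] is the last of several moves. *)
Lemma has_sides_exists r (m : 'I_r -> R * R) a :
  (forall j, m j != 0) -> pos_ordered m -> row_convex a -> exists u, has_sides m a u.
Proof.
case: r m a => [|r] m a m0 m_pos cvx; first by exists 0; case.
wlog a0 : a cvx / a ord0.
  move=> wlog_a0; case: (boolP (a ord0)) => [|na0]; first exact: wlog_a0.
  have [|//|u hu] := wlog_a0 (fun j => ~~ a j).
    by move=> j1 j2 j3 /cvx c /(can_inj negbK)/c->.
  exists (- u) => j; have := has_sidesN hu j; by rewrite negbK.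
have [l al max_l] : exists2 l : 'I_r.+1, a l & forall j, a j -> (j <= l)%N.
  by case: (arg_maxnP (fun l : 'I_r.+1 => l : nat) a0) => l al max_l; exists l.
have aE j : a j = (j <= l)%N.
  apply/idP/idP => [|jl]; first exact: max_l.
  by rewrite (cvx ord0 j l) ?a0 ?al.
(* The case [r <= l] comes first: the row is [true] everywhere and there is no move [l.+1]. *)
have [lr|lr] := ltnP l r; last first.
  have l_max : l = ord_max.
    by apply: val_inj; apply/eqP; rewrite eqn_leq lr -ltnS ltn_ord.
  have le_max j : 0 <= det2 (m j) (m l).
    by apply: pos_ordered_le; rewrite // l_max leq_ord.
  have ge_min j : 0 <= det2 (m ord0) (m j) by apply: pos_ordered_le.
  have aT j : a j by rewrite aE l_max leq_ord.
  (* For a single move [m l - m ord0] vanishes; a quarter turn of [m ord0] serves instead. *)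
  have [r0|r_gt0] := posnP r.
    exists (- (m ord0).2, (m ord0).1) => j; rewrite aT expr0 mul1r.
    have -> : j = ord0 by apply: val_inj => /=; have := ltn_ord j; lia.
    have := m0 ord0; rewrite /det2 /=; case: (m ord0) => x y /=.
    rewrite xpair_eqE negb_and mulrN opprK -!expr2 => xy0.
    by rewrite lt0r paddr_eq0 ?sqr_ge0 // !sqrf_eq0 negb_and xy0 addr_ge0 ?sqr_ge0.
  (* At [j = 0] the contribution of [m l] is positive, elsewhere that of [- m ord0]. *)
  exists (m l - m ord0) => j; rewrite aT expr0 mul1r det2Dr det2Nr -det2C.
  have := le_max j; have := ge_min j.
  have [j0|/(m_pos ord0)] := posnP j; last lra.
  have /m_pos : (j < l)%N by rewrite j0 l_max.
  lra.
have ltl1 : (l.+1 < r.+1)%N by [].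
exists (m l + m (Ordinal ltl1)) => j; rewrite aE det2Dr.
have [jl|lj] := leqP j l.
  have : 0 < det2 (m j) (m (Ordinal ltl1)) by apply: m_pos; rewrite ltnS.
  by have := pos_ordered_le m_pos jl; rewrite expr0; lra.
have := m_pos _ _ lj.
have : 0 <= det2 (m (Ordinal ltl1)) (m j) by apply: pos_ordered_le.
by rewrite expr1 (det2C (m j)) (det2C (m j)); lra.
Qed.

End Plane.

(** * Realizing three rows at once, and approximation by lattice points *)

Section Realization.
Variable R : realType.
Implicit Types (u v w x : R * R).

Lemma det2_cramer x y z : det2 x y != 0 ->
  (det2 z y / det2 x y) *: x + (det2 x z / det2 x y) *: y = z.
Proof.
case: x y z => [x1 x2] [y1 y2] [z1 z2]; rewrite /det2 /= => xy0.
by apply: injective_projections; rewrite /= /GRing.scale /=; field.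
Qed.

Lemma has_sidesZ r (m : 'I_r -> R * R) a K u :
  0 < K -> has_sides m a u -> has_sides m a (K *: u).
Proof. by move=> K0 hu j; rewrite det2Zr mulrCA mulr_gt0 ?hu. Qed.

Lemma has_sides_eq r (m : 'I_r -> R * R) a b u :
  a =1 b -> has_sides m a u -> has_sides m b u.
Proof. by move=> ab hu j; rewrite -ab. Qed.

Lemma has_sides_mul r (m : 'I_r -> R * R) a b u v j :
  has_sides m a u -> has_sides m b v ->
  0 < (-1) ^+ (a j (+) b j) * (det2 (m j) u * det2 (m j) v).
Proof.
move=> /(_ j) hu /(_ j) hv; have := mulr_gt0 hu hv.
by rewrite mulrACA -signr_addb addbN addNb negbK.
Qed.

(** By the Plücker relation [det2 u v * det2 x y] and [det2 u v * det2 x z] both have the sign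
    opposite to [det2 u x * det2 v x]. *)
Lemma same_orientation x y z u v :
  0 < det2 u x * det2 u y -> 0 < det2 u x * det2 u z ->
  det2 v x * det2 v y < 0 -> det2 v x * det2 v z < 0 ->
  0 < det2 x y * det2 x z.
Proof.
move=> ux_uy ux_uz vx_vy vx_vz.
have := det2_plucker u v x y; have := det2_plucker u v x z.
move: (det2 u v) (det2 x y) (det2 x z) ux_uy ux_uz vx_vy vx_vz => d dy dz.
move: (det2 u x) (det2 u y) (det2 u z) (det2 v x) (det2 v y) (det2 v z).
move=> ux uy uz vx vy vz ux_uy ux_uz vx_vy vx_vz dzE dyE.
have vy_vz : 0 < vy * vz.
  have : 0 < (vx * vy) * (vx * vz) by rewrite nmulr_rgt0.
  by rewrite mulrACA pmulr_rgt0 // lt0r mulf_eq0 orbb sqr_ge0 andbT;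
    apply: contraTneq vx_vy => ->; rewrite mul0r ltxx.
have uy_uz : 0 < uy * uz.
  have : 0 < (ux * uy) * (ux * uz) by rewrite mulr_gt0.
  by rewrite mulrACA pmulr_rgt0 // lt0r mulf_eq0 orbb sqr_ge0 andbT;
    apply: contraTneq ux_uy => ->; rewrite mul0r ltxx.
have : 0 < (d * dy) * (d * dz).
  rewrite -dyE -dzE.
  rewrite (_ : _ * _ = ux ^+ 2 * (vy * vz) + vx ^+ 2 * (uy * uz)
     - (ux * uy) * (vx * vz) - (ux * uz) * (vx * vy)); last by ring.
  have := mulr_ge0 (sqr_ge0 ux) (ltW vy_vz).
  have := mulr_ge0 (sqr_ge0 vx) (ltW uy_uz).
  have : (ux * uy) * (vx * vz) < 0 by rewrite pmulr_rlt0.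
  have : (ux * uz) * (vx * vy) < 0 by rewrite pmulr_rlt0.
  lra.
have d2 := sqr_ge0 d.
by rewrite mulrACA -expr2; nra.
Qed.

(** The condition relating [a], [b], [c] is what antisymmetry and transitivity say about the rows of
    two consecutive differences and of their sum. *)
Lemma three_rows_realizable r (m : 'I_r -> R * R) (a b c : 'I_r -> bool) :
  (forall j, m j != 0) -> pos_ordered m ->
  row_convex a -> row_convex b -> row_convex c ->
  (forall j, a j = b j -> c j = a j) ->
  exists u v, [/\ has_sides m a u, has_sides m b v & has_sides m c (u + v)].
Proof.
move=> m0 m_pos cvxa cvxb cvxc abc.
have [x hx] := has_sides_exists m0 m_pos cvxa.
have [y hy] := has_sides_exists m0 m_pos cvxb.
have [z hz] := has_sides_exists m0 m_pos cvxc.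
have [/forallP ac|/forallPn[j1 ac1]] := boolP [forall j, a j == c j].
  have [K [K0 hK]] := has_sides_dominated y hx.
  exists (K *: x), y; split=> //; first exact: has_sidesZ.
  by apply: has_sides_eq hK => j; apply/eqP.
have [/forallP bc|/forallPn[j2 bc2]] := boolP [forall j, b j == c j].
  have [K [K0 hK]] := has_sides_dominated x hy.
  exists x, (K *: y); split=> //; first exact: has_sidesZ.
  by rewrite addrC; apply: has_sides_eq hK => j; apply/eqP.
have [/forallP ab|/forallPn[p abp]] := boolP [forall j, a j != b j].
  have [K [K0 hK]] := has_sides_dominated z hx.
  (* Opposite rows: two long, nearly opposite vectors whose sum is exactly [z]. *)
  exists (K *: x + z), (- (K *: x)); split=> //; last by rewrite addrAC subrr add0r.
  apply: has_sides_eq (has_sidesN (has_sidesZ K0 hx)) => j.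
  by have := ab j; case: (a j); case: (b j).
(* From here on all three rows agree at [p], while [c] equals only [b] at [j1] and only [a] at
   [j2]. *)
have {}abp : b p = a p by move: abp; rewrite negbK => /eqP.
have acp : c p = a p by apply: abc.
have ab1 : b j1 = c j1.
  have := abc j1; move: ac1.
  by case: (a j1); case: (b j1); case: (c j1) => // _ /(_ erefl).
have ab2 : a j2 = c j2.
  have := abc j2; move: bc2.
  by case: (a j2); case: (b j2); case: (c j2) => // _ /(_ erefl).
(* [Dx] and [Dy] together make both Cramer coefficients of [z] with respect to [x] and [y]
   positive. *)
have Dx : 0 < det2 x y * det2 x z.
  apply: (@same_orientation _ _ _ (m p) (m j1)).
  - by have := has_sides_mul p hx hy; rewrite abp addbb mul1r.
  - by have := has_sides_mul p hx hz; rewrite acp addbb mul1r.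
  - have := has_sides_mul j1 hx hy; rewrite ab1.
    by move: ac1; case: (a j1); case: (c j1) => //= _; rewrite mulN1r oppr_gt0.
  - have := has_sides_mul j1 hx hz.
    by move: ac1; case: (a j1); case: (c j1) => //= _; rewrite mulN1r oppr_gt0.
have Dy : 0 < det2 y x * det2 y z.
  apply: (@same_orientation _ _ _ (m p) (m j2)).
  - by have := has_sides_mul p hy hx; rewrite abp addbb mul1r.
  - by have := has_sides_mul p hy hz; rewrite abp acp addbb mul1r.
  - have := has_sides_mul j2 hy hx; rewrite ab2.
    by move: bc2; case: (b j2); case: (c j2) => //= _; rewrite mulN1r oppr_gt0.
  - have := has_sides_mul j2 hy hz.
    by move: bc2; case: (b j2); case: (c j2) => //= _; rewrite mulN1r oppr_gt0.
have Dxy : det2 x y != 0 by apply: contraTneq Dx => ->; rewrite mul0r ltxx.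
have div_gt0 e : 0 < det2 x y * e -> 0 < e / det2 x y.
  have -> : e / det2 x y = (det2 x y * e) * (det2 x y)^-1 ^+ 2 by field.
  by move=> ?; rewrite mulr_gt0 // exprn_even_gt0 //= invr_eq0.
exists ((det2 z y / det2 x y) *: x), ((det2 x z / det2 x y) *: y); split.
- by apply/has_sidesZ/hx/div_gt0; rewrite (det2C x) (det2C z) mulrNN.
- by apply/has_sidesZ/hy/div_gt0.
- by rewrite det2_cramer.
Qed.

Definition floor_point (n : nat) (y : R * R) : int * int :=
  (Num.floor (n.+1%:R * y.1), Num.floor (n.+1%:R * y.2)).

(** The sequence is squeezed between [y - 1/(n+1)] and [y]. *)
Lemma cvg_floor_div (y : R) :
  n.+1%:R^-1 * (Num.floor (n.+1%:R * y))%:~R @[n --> \oo] --> y.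
Proof.
apply: (@squeeze_cvgr _ _ _ _ (fun n => y - harmonic n) (fun=> y)).
- near=> n; rewrite /harmonic /=.
  have n0 : 0 < n.+1%:R :> R by [].
  have := floor_itv (n.+1%:R * y); rewrite intrD.
  rewrite ler_pdivrMl // ler_pdivlMl // mulrBr mulfV ?gt_eqF //; lra.
- rewrite -[X in _ --> X]subr0; apply: cvgB; [exact: cvg_cst|exact: cvg_harmonic].
- exact: cvg_cst.
Unshelve. all: by end_near. Qed.

Lemma cvg_floor_point y :
  n.+1%:R^-1 *: point_of_int R (floor_point n y) @[n --> \oo] --> y.
Proof.
by case: y => y1 y2; exact: cvg_pair (@cvg_floor_div y1) (@cvg_floor_div y2).
Qed.

Lemma cvg_det2 T (F : set_system T) (FF : Filter F) u (f : T -> R * R) y :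
  f t @[t --> F] --> y -> det2 u (f t) @[t --> F] --> det2 u y.
Proof.
move=> fy.
have f1 : (f t).1 @[t --> F] --> y.1.
  exact: (cvg_comp _ _ fy (@cvg_fst _ _ (nbhs y.1) (nbhs y.2) _)).
have f2 : (f t).2 @[t --> F] --> y.2.
  exact: (cvg_comp _ _ fy (@cvg_snd _ _ (nbhs y.1) (nbhs y.2) _)).
by apply: cvgB; apply: cvgM; [exact: cvg_cst|exact: f2|exact: cvg_cst|exact: f1].
Qed.

Lemma exists_integer_configuration q r (B : set (R * R)) (m : 'I_r -> R * R)
    (w : 'I_q -> R * R) : B° !=set0 ->
  exists n (z : 'I_q -> int * int), [/\ (1 <= n)%N,
    forall i, working_board B n (z i) &
    forall i k j, 0 < det2 (m j) (w k - w i) ->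
      0 < det2 (m j) (point_of_int R (z k) - point_of_int R (z i))].
Proof.
move=> [p Bp].
have near_B y : B° y -> nbhs y B°.
  by move=> By; apply: open_nbhs_nbhs; split=> //; exact: open_interior.
(* Shrinking [w] towards [p] multiplies all differences by [e], which keeps the signs of
   determinants. *)
have [e [e0 Be]] : exists e : R, 0 < e /\ forall i, B° (p + e *: w i).
  have : \forall e \near (0 : R)^'+, 0 < e /\ forall i, B° (p + e *: w i).
    apply: filterI; first exact: nbhs_right_gt.
    apply: (@filter_forall R _ (fun i e => B° (p + e *: w i)) (0 : R)^'+) => i.
    have ce : p + e *: w i @[e --> (0 : R)] --> p.
      rewrite -[X in _ --> X]addr0 -(scale0r (w i)).
      by apply: cvgD; [exact: cvg_cst|apply: cvgZr_tmp; exact: cvg_id].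
    exact: (cvg_at_right_filter ce (near_B _ Bp)).
  by move=> /filter_ex.
pose y i := p + e *: w i.
pose f i n := n.+1%:R^-1 *: point_of_int R (floor_point n (y i)).
have fy i : f i n @[n --> \oo] --> y i by exact: cvg_floor_point.
(* Besides [1 <= n] these are finitely many open conditions that hold at the limits [y i]. *)
have : \forall n \near \oo, [/\ (1 <= n)%N, forall i, B° (f i n) &
    forall i k j, 0 < det2 (m j) (w k - w i) -> 0 < det2 (m j) (f k n - f i n)].
  near=> n; split.
  - by near: n; exact: nbhs_infty_ge.
  - near: n; apply: filter_forall => i; exact: (fy i _ (near_B _ (Be i))).
  - near: n; apply: filter_forall => i; apply: filter_forall => k.
    apply: filter_forall => j.
    have [wik|/negP nwik] := boolP (0 < det2 (m j) (w k - w i)); last first.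
      by apply: nearW => n wik; case: nwik.
    have : 0 < det2 (m j) (y k - y i).
      by rewrite /y opprD addrACA subrr add0r -scalerBr det2Zr mulr_gt0.
    have /(cvgr_gt _) : det2 (m j) (f k n - f i n) @[n --> \oo]
        --> det2 (m j) (y k - y i).
      by apply: cvg_det2; apply: cvgB; exact: fy.
    by move=> /[apply]; apply: filterS => n ? _.
move=> /filter_ex[n [n1 Bf pos]].
(* Multiplying back by [n.+1], the dilation factor in [working_board], recovers lattice points. *)
have fE i : point_of_int R (floor_point n (y i)) = n.+1%:R *: f i n.
  by rewrite scalerA mulfV ?scale1r.
exists n, (fun i => floor_point n (y i)); split=> // [i|i k j /pos pos_ikj].
  by exists (f i n).
by rewrite !fE -scalerBr det2Zr mulr_gt0.
Unshelve. all: by end_near. Qed.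

End Realization.

(** * Necessity of admissibility, and reduction to upright moves *)

Section RiderTypes.
Variables (R : realType) (q r : nat).
Implicit Types (m : 'I_r -> R * R) (B : set (R * R)) (z : 'I_q -> int * int).
Implicit Types (u v : R * R).

Lemma side_type_of m z i j k : side (type_of m z) i j k =
  (0 < det2 (m j) (point_of_int R (z k) - point_of_int R (z i))).
Proof.
have [<-|ik] := eqVneq i k; first by rewrite sideii subrr /det2 !mulr0 subrr ltxx.
rewrite (side_finfun (fun i j k =>
  0 < det2 (m j) (point_of_int R (z k) - point_of_int R (z i)))).
by rewrite ik.
Qed.

Lemma nonattackingP m z : (forall j, m j != 0) ->
  nonattacking m z <-> forall i k, i != k -> forall j,
    det2 (m j) (point_of_int R (z k) - point_of_int R (z i)) != 0.
Proof.
by move=> m0; split=> h i k ik j; apply/(move_lineP _ _ (m0 j)); exact: h.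
Qed.

(** Antisymmetry holds because no determinant vanishes, transitivity because [det2] is additive in
    its second argument. *)
Lemma type_of_admissible m z : (forall j, m j != 0) -> pos_ordered m ->
  nonattacking m z -> admissible (type_of m z).
Proof.
move=> m0 m_pos /(nonattackingP _ m0) na; split.
- move=> i j k ik; rewrite !side_type_of -opprB det2Nr oppr_gt0.
  by rewrite -leNgt le_eqVlt (negbTE (na _ _ ik j)).
- move=> i j k l; rewrite !side_type_of => ik kl.
  have -> : point_of_int R (z l) - point_of_int R (z i)
    = (point_of_int R (z k) - point_of_int R (z i))
    + (point_of_int R (z l) - point_of_int R (z k)) by rewrite [RHS]addrC subrKA.
  by rewrite det2Dr addr_gt0.
- move=> i k j1 j2 j3; have [<-|ik] := eqVneq i k; first by rewrite !sideii.
  by rewrite !side_type_of; apply: pos_ordered_convex => // j; exact: na.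
Qed.

(** The nonzero vectors left over have angles from -π/2, excluded, to π/2, included. On this range
    the angle increases with the slope, and the vertical direction, of slope [+oo], comes last. *)
Definition downward v := (v.1 < 0) || (v.1 == 0) && (v.2 < 0).

Definition upright m j := if downward (m j) then - m j else m j.

Definition downward_moves m := [set j | downward (m j)]%SET.

Lemma upright_neq0 m : (forall j, m j != 0) -> forall j, upright m j != 0.
Proof. by move=> m0 j; rewrite /upright; case: ifP; rewrite ?oppr_eq0. Qed.

Lemma slopeN v : slope (- v) = slope v.
Proof. by rewrite /slope /= oppr_eq0 invrN mulrNN. Qed.

Lemma slope_lt_det2 u v : u != 0 -> v != 0 -> ~~ downward u -> ~~ downward v ->
  (slope u < slope v)%E -> 0 < det2 u v.
Proof.
case: u v => [u1 u2] [v1 v2]; rewrite /downward /slope /det2 !xpair_eqE /=.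
case: (ltrgt0P u1) => //= u1s; case: (ltrgt0P v1) => //= v1s.
- by rewrite lte_fin ltr_pdivrMr // mulrAC ltr_pdivlMr // => _ _ _ _; lra.
(* Here [v] is vertical, and not being downward forces [v2 > 0]. *)
- move=> _ v20 _; rewrite -leNgt v1s => v2_ge0 _.
  by rewrite mulr0 subr0 mulr_gt0 // lt0r v20.
Qed.

Lemma upright_pos_ordered m : is_rider m -> pos_ordered (upright m).
Proof.
move=> [m0 m_incr] j l /m_incr slope_jl.
have up i : ~~ downward (upright m i).
  rewrite /upright; case: ifPn => // ; rewrite /downward /=.
  by case: ltrgt0P => //= ?; rewrite ?oppr_eq0; case: ltrgt0P; rewrite //=; lra.
apply: slope_lt_det2; rewrite ?upright_neq0 //.
have slope_up i : slope (upright m i) = slope (m i).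
  by rewrite /upright; case: ifP; rewrite ?slopeN.
by rewrite !slope_up.
Qed.

Lemma nonattacking_upright m z : (forall j, m j != 0) ->
  nonattacking (upright m) z <-> nonattacking m z.
Proof.
move=> m0.
have det0 u j : (det2 (upright m j) u == 0) = (det2 (m j) u == 0).
  by rewrite /upright; case: ifP; rewrite // det2Nl oppr_eq0.
rewrite (nonattackingP _ m0) (nonattackingP _ (upright_neq0 m0)).
by split=> na i k ik j; have := na i k ik j; rewrite det0.
Qed.

Lemma type_of_upright m z : (forall j, m j != 0) -> nonattacking m z ->
  type_of m z = reorient (downward_moves m) (type_of (upright m) z).
Proof.
move=> m0 /(nonattackingP _ m0) na; apply: side_inj => i j k ik.
rewrite side_reorient // !side_type_of inE /upright.
have /negbTE := na i k ik j; case: ifP => //= _ det0.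
by rewrite det2Nl oppr_gt0 -leNgt le_eqVlt eq_sym det0.
Qed.

Lemma labelled_types_upright B m : (forall j, m j != 0) ->
  labelled_types q B m
    = (reorient (downward_moves m) @: labelled_types q B (upright m))%SET.
Proof.
move=> m0; apply/setP => T; apply/idP/imsetP.
  rewrite inE => /asboolP[n [n1 [z [Bz na TE]]]].
  exists (type_of (upright m) z); last by rewrite TE type_of_upright.
  rewrite inE; apply/asboolP; exists n; split=> //; exists z; split=> //.
  exact/nonattacking_upright.
move=> -[T']; rewrite inE => /asboolP[n [n1 [z [Bz na ->]]]] ->; rewrite inE.
have {}na : nonattacking m z by apply/nonattacking_upright.
apply/asboolP; exists n; split=> //; exists z; split=> //.
by rewrite -type_of_upright.
Qed.

End RiderTypes.

(** * Labelled and unlabelled types of three pieces *)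

Lemma labelled_types_pos_ordered (R : realType) r (B : set (R * R))
    (m : 'I_r -> R * R) : is_board B -> (forall j, m j != 0) -> pos_ordered m ->
  labelled_types 3 B m = admissible_types 3 r.
Proof.
move=> [_ B0] m0 m_pos; apply/setP => T; rewrite !inE; apply: asbool_equiv_eq.
split=> [[n [_ [z [_ na ->]]]]|admT]; first exact: type_of_admissible.
have [flip trans cvx] := admT.
have rc i k : row_convex (fun j => side T i j k) by move=> ? ? ?; exact: cvx.
have [j /= T01|u [v [hu hv huv]]] :=
    three_rows_realizable m0 m_pos (rc o0 o1) (rc o1 o2) (rc o0 o2).
  (* Where the first two rows agree, transitivity gives the third, applied to the reversed pairs if
     the common value is [false]. *)
  case: (boolP (side T o0 j o1)) (T01) => [h01 /esym h12|h01 /esym h12].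
    exact: trans h01 h12.
  apply/negbTE; rewrite -flip //; apply: (trans _ _ o1).
    by rewrite flip // h12.
  by rewrite flip.
pose w (i : 'I_3) : R * R := if i == o0 then 0 else if i == o1 then u else u + v.
have hw (i k : 'I_3) : (i < k)%N -> has_sides m (fun j => side T i j k) (w k - w i).
  case: (ord3P i) => ->; case: (ord3P k) => -> // _; rewrite /w /= ?subr0 //.
  by rewrite addrC addKr.
have side_w i j k : i != k -> side T i j k -> 0 < det2 (m j) (w k - w i).
  move=> ik Tijk; case: (ltngtP i k) => [lt_ik|lt_ki|/val_inj ik0].
  - by have := hw _ _ lt_ik j; rewrite Tijk mul1r.
  - have := hw _ _ lt_ki j; rewrite flip // Tijk mulN1r -det2Nr opprB.
    exact.
  - by rewrite ik0 eqxx in ik.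
have [n [z [n1 Bz zw]]] := exists_integer_configuration m w B0.
(* The lattice approximation preserves positive determinants only; a [false] side is read off from
   the reversed pair. *)
have zT i j k : i != k ->
    0 < (-1) ^+ (~~ side T i j k)
        * det2 (m j) (point_of_int R (z k) - point_of_int R (z i)).
  move=> ik; case: (boolP (side T i j k)) => Tijk /=.
    by rewrite mul1r; apply/zw/side_w.
  by rewrite mulN1r -det2Nr opprB; apply/zw/side_w; rewrite 1?eq_sym // flip.
exists n; split=> //; exists z; split=> //.
  apply/nonattackingP => // i k ik j.
  by apply: contraTneq (zT i j k ik) => ->; rewrite mulr0 ltxx.
apply: side_inj => i j k ik; rewrite side_type_of.
have := zT i j k ik; case: (side T i j k) => /=.
  by rewrite mul1r => ->.
by rewrite mulN1r oppr_gt0 => /lt_gtF ->.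
Qed.

(** The right-hand side involves [m] only through its set of downward moves and does not mention
    [B]; this yields independence up to reorientation. *)
Lemma labelled_typesE (R : realType) r (B : set (R * R)) (m : 'I_r -> R * R) :
  is_board B -> is_rider m ->
  labelled_types 3 B m = (reorient (downward_moves m) @: admissible_types 3 r)%SET.
Proof.
move=> BB rm; have m0 := rm.1.
rewrite labelled_types_upright // labelled_types_pos_ordered //.
  exact: upright_neq0.
exact: upright_pos_ordered.
Qed.

Lemma unlabelled_typesE (R : realType) r (B : set (R * R)) (m : 'I_r -> R * R) :
  is_board B -> is_rider m ->
  unlabelled_types 3 B m
  = [set [set reorient (downward_moves m) T | T in C]%SET
      | C : unlabelled_type 3 r in (@unlabel 3 r @: admissible_types 3 r)%SET]%SET.
Proof.
move=> BB rm; rewrite /unlabelled_types labelled_typesE // -!imset_comp.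
by apply: eq_imset => T /=; rewrite unlabel_reorient.
Qed.

Theorem theorem3p2 (R : realType) (r : nat) (r_ge1 : (1 <= r)%N) :
  (forall (B : set (R * R)) (m : 'I_r -> R * R),
     is_board B -> is_rider m ->
     #|unlabelled_types 3 B m|%:R
       = 1 / 3%:R * r%:R * (r%:R ^+ 2 + 3%:R * r%:R - 1) :> rat)
  /\
  (forall (B B' : set (R * R)) (m m' : 'I_r -> R * R),
     is_board B -> is_board B' -> is_rider m -> is_rider m' ->
     labelled_eq_up_to_reorientation
       (labelled_types 3 B m) (labelled_types 3 B' m')
     /\
     unlabelled_eq_up_to_reorientation
       (unlabelled_types 3 B m) (unlabelled_types 3 B' m')).
Proof.
case: r r_ge1 => // r _; split=> [B m BB rm|B B' m m' BB BB' rm rm'].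
  (* Reorientation is an involution, so it does not affect the count. *)
  rewrite unlabelled_typesE // card_imset; last exact/imset_inj/inv_inj/reorientK.
  rewrite card_unlabel_admissible card_between_levels.
  have /(congr1 (fun n => n%:R : rat)) := sum_levelsE r.+1.
  rewrite !natrD ![(3 * _)%:R]natrM !natrX.
  move: (sum_levels _)%:R (r.+1%:R : rat) => s x; lra.
(* Reorienting along the symmetric difference undoes the reversals for [m] and performs those for
   [m']. *)
pose S := ((downward_moves m :\: downward_moves m')
           :|: (downward_moves m' :\: downward_moves m))%SET.
have SE T : reorient S (reorient (downward_moves m) T)
    = reorient (downward_moves m') T :> labelled_type 3 r.+1.
  by apply: reorient_comp => j; rewrite !inE; case: downward; case: downward.
split; exists S.
  rewrite !labelled_typesE // -imset_comp.
  by apply: eq_imset => T /=; rewrite SE.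
rewrite !unlabelled_typesE // -[in RHS]imset_comp.
by apply: eq_imset => C /=; rewrite -imset_comp; apply: eq_imset => T /=; rewrite SE.
Qed.
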